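(* Let $(S,s)$ be a rational surface singularity and let $\{E_i\}$ be the exceptional curves of its minimal desingularization. For any two distinct exceptional curves $E_i$, $E_j$ there exists $f\in\mathcal{O}_{S,s}$ with $\operatorname{ord}_{E_i}(f)\neq\operatorname{ord}_{E_j}(f)$. Consequently the relation on the set of exceptional curves defined by $E_i\leq E_j$ if and only if $\operatorname{ord}_{E_i}(f)\leq\operatorname{ord}_{E_j}(f)$ for all $f\in\mathcal{O}_{S,s}$ is a partial order.
   Context: The base field $k$ is algebraically closed. Let $p:X\to S$ be the minimal desingularization. For a nonzero $f\in\mathcal{O}_{S,s}$, write the divisor of $p^*(f)$ as $\mu_iE_i+(f')$, where $(f')$ does not have $E_i$ as a component; then $\operatorname{ord}_{E_i}(f):=\mu_i$. (Convention: $\operatorname{ord}_{E_i}(0)=\infty$.) *)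

(* Defs.v *)
From mathcomp Require Import all_boot all_order all_algebra.
From mathcomp Require Import mathcomp_extra boolp classical_sets functions.
From mathcomp Require Import constructive_ereal topology.
From Stdlib Require Relation_Definitions.

Set Implicit Arguments.
Unset Strict Implicit.
Unset Printing Implicit Defensive.
Import Order.TTheory GRing.Theory Num.Theory.
Local Open Scope classical_set_scope.
Local Open Scope ring_scope.

(* Only integral schemes and birational morphisms occur, so every ring below
   is a subring of one function field K, given as a set of elements of K. *)

Section Subrings.
Variable K : fieldType.
Implicit Types (A B I P O W : set K).

Definition is_subring A : Prop := GRing.subring_closed (mem A).

Definition is_ideal A I : Prop :=
  [/\ I `<=` A, I 0 & forall a x y, A a -> I x -> I y -> I (a * x + y)].

Definition prime_ideal A P : Prop :=
  [/\ is_ideal A P, ~ P 1 &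
      forall a b, A a -> A b -> P (a * b) -> P a \/ P b].

Definition prime_spectrum A : set (set K) := [set P | prime_ideal A P].

Definition ideal_span A n (g : 'I_n -> K) : set K :=
  [set x | exists2 c : 'I_n -> K, (forall i, A (c i)) &
           x = \sum_(i < n) c i * g i].

Definition noetherian_ring A : Prop :=
  forall I, is_ideal A I -> exists n (g : 'I_n -> K), I = ideal_span A g.

Definition finitely_generated_over B A : Prop :=
  exists n (g : 'I_n -> K), A = smallest is_subring (B `|` range g).

Definition localization A P : set K :=
  [set x | exists a b, [/\ A a, A b, ~ P b & x = a / b]].

Definition nonunits O : set K :=
  [set a | O a /\ forall b, O b -> a * b <> 1].

(* The longest strict chains of members of the family C have d inclusions. *)
Definition chain_of_length T (C : set (set T)) (n : nat) : Prop :=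
  exists Z : nat -> set T, (forall i, (i <= n)%N -> C (Z i)) /\
                           (forall i, (i < n)%N -> Z i `<` Z i.+1).
Definition has_dimension T (C : set (set T)) (d : nat) : Prop :=
  chain_of_length C d /\ ~ chain_of_length C d.+1.

(* For a local ring O, whose maximal ideal is the set of its nonunits. *)
Definition regular_local_ring O : Prop :=
  noetherian_ring O /\
  exists d (g : 'I_d -> K),
    has_dimension (prime_spectrum O) d /\ nonunits O = ideal_span O g.

Definition integrally_closed O : Prop :=
  forall (a : K) (q : {poly K}),
    q \is monic -> q \is a polyOver (mem O) -> root q a -> O a.

Definition valuation_ring W : Prop :=
  is_subring W /\ forall a, W a \/ W a^-1.

(* f = u * t ^ n with u a unit and t a uniformizer of the discrete valuation
   ring O of K. *)
Definition has_valuation O (f : K) (n : int) : Prop :=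
  exists t u, [/\ nonunits O = [set a * t | a in O], O u, ~ nonunits O u &
                  f = u * t ^ n].

End Subrings.

(* A local ring homomorphism from the subring O of K to the field L; it is
   only meaningful on O. *)
Definition local_hom_to_field (K L : fieldType) (O : set K) (phi : K -> L) :=
  [/\ phi 1 = 1,
      forall a b, O a -> O b -> phi (a + b) = phi a + phi b,
      forall a b, O a -> O b -> phi (a * b) = phi a * phi b &
      forall a, O a -> (phi a = 0 <-> nonunits O a)].

Definition irreducible_subset (T : topologicalType) (Z : set T) : Prop :=
  Z !=set0 /\
  forall F G, closed F -> closed G -> Z `<=` F `|` G -> Z `<=` F \/ Z `<=` G.

Definition irreducible_closed (T : topologicalType) : set (set T) :=
  [set Z | closed Z /\ irreducible_subset Z].

(* The open set U with the local rings (st x), x in U, is isomorphic to the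
   affine scheme Spec A, where A is a subring of K with fraction field K. *)
Definition affine_chart (K : fieldType) (T : topologicalType)
    (st : T -> set K) (U : set T) (A : set K) : Prop :=
  [/\ open U, is_subring A, localization A [set 0] = setT &
      exists phi : T -> set K,
        [/\ set_bij U (prime_spectrum A) phi,
            forall B, B `<=` U ->
              (open B <->
               exists2 I, I `<=` A & B = [set x | U x /\ ~ I `<=` phi x]) &
            forall x, U x -> st x = localization A (phi x)]].

(* An integral scheme with a chosen identification of its function field with
   K.  The restriction maps of the structure sheaf are then inclusions in K,
   and the sheaf is determined by its stalks: see [sections].  Distinct points
   may have the same stalk. *)
Record integral_scheme (K : fieldType) := IntegralScheme {
  points :> topologicalType;
  stalk : points -> set K;
  scheme_irreducible : irreducible_subset [set: points];
  scheme_locally_affine :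
    forall x, exists U A, U x /\ affine_chart stalk U A }.

Section Schemes.
Variable K : fieldType.
Implicit Types X Y S : integral_scheme K.

(* The ring of sections over U, for U open and nonempty. *)
Definition sections X (U : set X) : set K :=
  [set a | forall x, U x -> stalk x a].

Definition noetherian_scheme X : Prop :=
  exists n (U : 'I_n -> set X) (A : 'I_n -> set K),
    (forall i, affine_chart (@stalk K X) (U i) (A i) /\ noetherian_ring (A i))
    /\ forall x, exists i, U i x.

Definition regular_scheme X : Prop :=
  forall x : X, regular_local_ring (stalk x).

Definition normal_scheme X : Prop :=
  forall x : X, integrally_closed (stalk x).

(* The pair (x, phi) is a morphism Spec L -> X.  It extends to a morphism
   Spec W -> X, W a valuation ring of L, sending the closed point to y. *)
Definition extends_to_valuation_ring X (x : X) (L : fieldType) (phi : K -> L)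
    (W : set L) (y : X) : Prop :=
  [/\ closure [set x] y,
      forall a, stalk y a -> W (phi a) &
      forall a, nonunits (stalk y) a -> nonunits W (phi a)].

Definition separated_scheme X : Prop :=
  forall (x : X) (L : fieldType) (phi : K -> L) (W : set L) (y y' : X),
    local_hom_to_field (stalk x) phi -> valuation_ring W ->
    extends_to_valuation_ring x phi W y ->
    extends_to_valuation_ring x phi W y' -> y = y'.

(* A birational morphism: the map of function fields is the identity of K. *)
Definition birational_morphism X S (p : X -> S) : Prop :=
  [/\ continuous p,
      forall x, stalk (p x) `<=` stalk x &
      forall x, nonunits (stalk (p x)) `<=` nonunits (stalk x)].

Definition finite_type_morphism X S (p : X -> S) : Prop :=
  forall (V : set S) (B : set K), affine_chart (@stalk K S) V B ->
    exists n (U : 'I_n -> set X) (A : 'I_n -> set K),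
      (forall i, affine_chart (@stalk K X) (U i) (A i) /\
                 finitely_generated_over B (A i)) /\
      p @^-1` V = \bigcup_i U i.

(* Properness by the valuative criterion, S being noetherian. *)
Definition proper_morphism X S (p : X -> S) : Prop :=
  finite_type_morphism p /\
  forall (x : X) (L : fieldType) (phi : K -> L) (W : set L) (y : S),
    local_hom_to_field (stalk x) phi -> valuation_ring W ->
    extends_to_valuation_ring (p x) phi W y ->
    exists! x' : X, extends_to_valuation_ring x phi W x' /\ p x' = y.

Definition desingularization X S (p : X -> S) : Prop :=
  [/\ birational_morphism p, proper_morphism p & regular_scheme X].

Definition minimal_desingularization X S (p : X -> S) : Prop :=
  desingularization p /\
  forall Y (q : Y -> S), desingularization q ->
    exists2 h : Y -> X, birational_morphism h & forall y, p (h y) = q y.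

(* Vanishing of the stalk at s of R^1 p_* O_X, the colimit of the groups
   H^1 (p^-1 V, O_X) over the open neighbourhoods V of s.  Every class of
   H^1 is a Cech class, and a Cech class vanishes in H^1 if and only if it is
   a coboundary on the given cover. *)
Definition R1_direct_image_vanishes_at X S (p : X -> S) (s : S) : Prop :=
  forall (V : set S) (J : Type) (U : J -> set X) (c : J -> J -> K),
    open V -> V s ->
    (forall i, open (U i) /\ U i !=set0) -> p @^-1` V = \bigcup_i U i ->
    (forall i j, sections (U i `&` U j) (c i j)) ->
    (forall i j l, c i l = c i j + c j l) ->
    exists V' : set S, [/\ open V', V' s, V' `<=` V &
      exists b : J -> K,
        (forall i, sections (U i `&` p @^-1` V') (b i)) /\
        (forall i j, c i j = b j - b i)].

Section OverBaseField.
Variables (k : closedFieldType) (iota : {rmorphism k -> K}).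

(* A surface over k representing a germ at its only singular point s.  Being
   noetherian with residue field k at s is required instead of being of finite
   type over k, so that S may also be the spectrum of a local ring. *)
Definition normal_surface_singularity S (s : S) : Prop :=
  [/\ noetherian_scheme S /\ separated_scheme S,
      normal_scheme S /\ has_dimension (@irreducible_closed S) 2,
      forall (x : S) (a : k), stalk x (iota a),
      closed [set s] /\
        (forall a, stalk s a -> exists c, nonunits (stalk s) (a - iota c)) &
      ~ regular_local_ring (stalk s) /\
        (forall x : S, x <> s -> regular_local_ring (stalk x))].

Definition rational_surface_singularity S (s : S) : Prop :=
  normal_surface_singularity s /\
  exists X (p : X -> S),
    desingularization p /\ R1_direct_image_vanishes_at p s.

End OverBaseField.

(* Irreducible closed subsets of codimension 1. *)
Definition prime_divisor X (E : set X) : Prop :=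
  [/\ @irreducible_closed X E, E <> setT &
      forall Z, @irreducible_closed X Z -> E `<=` Z -> Z = E \/ Z = setT].

Definition exceptional_curve X S (p : X -> S) (s : S) (E : set X) : Prop :=
  prime_divisor E /\ p @` E = [set s].

(* The local ring of X at the generic point of E. *)
Definition local_ring_along X (E : set X) : set K :=
  [set a | exists2 x : X, E = closure [set x] & stalk x a].

(* The divisor of the rational function f <> 0, as the family of its
   coefficients at the prime divisors E of the regular scheme X. *)
Definition principal_divisor X (f : K) (E : set X) : int :=
  xget 0 [set n : int | has_valuation (local_ring_along E) f n].

(* For f in a stalk of S, the function p^* f is f itself as an element of K. *)
Definition ord X (E : set X) (f : K) : \bar int :=
  if f == 0 then +oo%E else (principal_divisor f E)%:E.

Definition exceptional_le X S (p : X -> S) (s : S)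
    (E F : {E : set X | exceptional_curve p s E}) : Prop :=
  forall f : K, stalk s f -> (ord (sval E) f <= ord (sval F) f)%E.

End Schemes.

(* Main.v *)
(* The local rings of X at the generic points of the exceptional curves are
   discrete valuation rings of K, since X is regular.  If ord_E and ord_F agree
   on O_(S,s), they agree on its fraction field K by multiplicativity, so the
   two valuation rings coincide.  Both generic points lie over s, so the
   uniqueness part of the valuative criterion of properness, applied to this
   common valuation ring, shows that they are equal, and E = F.  The
   antisymmetry of the relation is the contrapositive of the first claim. *)

Require Import Defs.
From mathcomp Require Import all_boot all_order all_algebra ring.
From mathcomp Require Import boolp functions.
From mathcomp Require Import classical_sets constructive_ereal topology.
From Stdlib Require Relation_Definitions.

Set Implicit Arguments.
Unset Strict Implicit.
Unset Printing Implicit Defensive.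
Import Order.TTheory GRing.Theory Num.Theory.
Local Open Scope classical_set_scope.
Local Open Scope ring_scope.

(** * Units, uniformizers and discrete valuations for a subring of a field *)

Section Subring.
Variables (K : fieldType) (O : set K).
Hypothesis subringO : is_subring O.

Lemma subring1 : O 1.
Proof. by case: subringO => + _ _; rewrite in_setE. Qed.

Lemma subringB x y : O x -> O y -> O (x - y).
Proof.
case: subringO => _ + _ Ox Oy => /(_ x y).
by rewrite !in_setE; apply.
Qed.

Lemma subringM x y : O x -> O y -> O (x * y).
Proof.
case: subringO => _ _ + Ox Oy => /(_ x y).
by rewrite !in_setE; apply.
Qed.

Lemma subring0 : O 0.
Proof. by rewrite -(subrr 1); apply: subringB; exact: subring1. Qed.

Lemma subringD x y : O x -> O y -> O (x + y).
Proof.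
move=> Ox Oy; rewrite -[y]opprK; apply: subringB => //.
by rewrite -sub0r; apply: subringB => //; exact: subring0.
Qed.

Lemma subringX x n : O x -> O (x ^+ n).
Proof.
move=> Ox; elim: n => [|n IHn]; first by rewrite expr0; exact: subring1.
by rewrite exprS; apply: subringM.
Qed.

(** Invertibility is phrased with the inverse taken in K, which makes products, inverses and integer
    powers of units immediate; [unit_inP] matches it with [nonunits]. *)
Definition unit_in (u : K) : Prop := [/\ u != 0, O u & O u^-1].

Lemma unit_inP u : unit_in u <-> O u /\ ~ nonunits O u.
Proof.
split=> [[u0 Ou Ou1]|[Ou nu]].
  by split=> // -[_ /(_ _ Ou1)]; rewrite divff.
have [b [Ob ub]] : exists b, O b /\ u * b = 1.
  by apply: contrapT => h; apply: nu; split=> // b Ob ub; apply: h; exists b.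
have u0 : u != 0.
  by apply/eqP => u0; move/eqP: ub; rewrite u0 mul0r eq_sym oner_eq0.
by split=> //; rewrite -[u^-1]mulr1 -ub mulKf.
Qed.

Lemma unit_inM u v : unit_in u -> unit_in v -> unit_in (u * v).
Proof.
move=> [u0 Ou Ou'] [v0 Ov Ov']; split; first by rewrite mulf_neq0.
- exact: subringM.
- by rewrite invfM; apply: subringM.
Qed.

Lemma unit_inV u : unit_in u -> unit_in u^-1.
Proof. by move=> [u0 Ou Ou']; split; rewrite ?invr_eq0 ?invrK. Qed.

Lemma unit_inX u (n : int) : unit_in u -> unit_in (u ^ n).
Proof.
have pos v m : unit_in v -> unit_in (v ^+ m).
  move=> [v0 Ov Ov']; split; first by rewrite expf_neq0.
  - exact: subringX.
  - by rewrite -exprVn; exact: subringX.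
by case: n => m uu; [exact: pos|apply: unit_inV; exact: pos].
Qed.

Lemma nonunit_mul t x : nonunits O t -> O x -> x * t <> 1.
Proof. by move=> [_ nt] Ox; rewrite mulrC; exact: nt. Qed.

(** If a positive power of t were a unit, [t ^- m.+1 * t ^+ m] would be an inverse of t in O. A
    negative exponent reduces to this case by inverting. *)
Lemma nonunit_exp t (n : int) :
  nonunits O t -> unit_in (t ^ n) -> n = 0.
Proof.
move=> nt; have [Ot _] := nt.
have pos m : ~ unit_in (t ^+ m.+1).
  move=> [tm0 _ Otm]; apply: (@nonunit_mul t (t ^- m.+1 * t ^+ m)) => //.
    by apply: subringM => //; exact: subringX.
  by rewrite -mulrA -exprSr mulVf.
case: n => [[//|m] /pos //|m].
by move/unit_inV; rewrite NegzE -exprnN invrK => /pos.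
Qed.

(** The condition [t != 0] excludes fields, whose maximal ideal is also principal, generated by
    0. *)
Definition uniformizer (t : K) : Prop :=
  t != 0 /\ nonunits O = [set a * t | a in O].

Lemma uniformizer_nonunit t : uniformizer t -> nonunits O t.
Proof. by move=> [_ ->]; exists 1; [exact: subring1|rewrite mul1r]. Qed.

Definition discrete_valuation_ring : Prop :=
  exists2 t, uniformizer t &
    forall f, f != 0 -> exists u (n : int), unit_in u /\ f = u * t ^ n.

Definition valuation_of (f : K) : int :=
  xget 0 [set n : int | has_valuation O f n].

(** The uniformizer is existentially quantified in [has_valuation], so uniqueness of the exponent
    has to compare two of them. Each is a multiple of the other, so t = w t' with w a unit; equating
    u t^n and u' t'^m then makes t'^(m - n) a unit, and [nonunit_exp] gives m = n. *)
Lemma valuation_ofE t u (n : int) :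
  uniformizer t -> unit_in u -> valuation_of (u * t ^ n) = n.
Proof.
move=> ut uu; have nt := uniformizer_nonunit ut.
have [t0 tE] := ut.
apply: xget_unique => /=.
  by exists t, u; have [] := (unit_inP u).1 uu.
move=> m [t' [u' [t'E Ou' nu' fE]]].
have uu' : unit_in u' by apply/unit_inP.
have [w Ow tw] : [set a * t' | a in O] t by rewrite -t'E.
have t'0 : t' != 0 by apply: contraNneq t0 => t'0; rewrite -tw t'0 mulr0.
have nt' : nonunits O t'.
  by rewrite t'E; exists 1; [exact: subring1|rewrite mul1r].
have [w' Ow' tw'] : [set a * t | a in O] t' by rewrite -tE.
have ww' : w * w' = 1 by apply: (mulIf t0); rewrite mul1r -mulrA tw' tw.
have w0 : w != 0 by apply: contraNneq t0 => w0; rewrite -tw w0 mul0r.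
have uw : unit_in w by split=> //; rewrite -[w^-1]mulr1 -ww' mulKf.
have [u'0 _ _] := uu'; have [u0 _ _] := uu.
apply/eqP; rewrite -subr_eq0; apply/eqP/(nonunit_exp nt').
suff -> : t' ^ (m - n) = u * w ^ n * u'^-1.
  by apply: unit_inM; [apply: unit_inM => //; exact: unit_inX|exact: unit_inV].
rewrite expfzDr // -invr_expz.
apply: (mulfI u'0); rewrite mulrA -fE -tw expfzMl.
have := expfz_neq0 n t'0; move: (t' ^ n) (w ^ n) => a b a0.
by field; rewrite u'0 a0.
Qed.

Hypothesis dvrO : discrete_valuation_ring.

Lemma valuation_ofM f g : f != 0 -> g != 0 ->
  valuation_of (f * g) = valuation_of f + valuation_of g.
Proof.
have [t ut tP] := dvrO; have [t0 _] := ut.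
move=> /tP[u [n [uu ->]]] /tP[v [m [uv ->]]].
by rewrite mulrACA -expfzDr // !valuation_ofE //; exact: unit_inM.
Qed.

Lemma valuation_of_ge0 f : f != 0 -> O f <-> 0 <= valuation_of f.
Proof.
have [t ut tP] := dvrO; have [t0 _] := ut.
have nt := uniformizer_nonunit ut; have [Ot _] := nt.
move=> /tP[u [n [uu ->]]]; rewrite valuation_ofE //.
have [u0 Ou Ou'] := uu.
case: n => n; split=> //.
- by move=> _; apply: subringM => //; exact: subringX.
- rewrite NegzE -exprnN => Of; exfalso.
  (* The cofactor equals t^-1, written as a product of elements of O. *)
  apply: (@nonunit_mul t (t ^+ n * (u^-1 * (u * t ^- n.+1)))) => //.
    by apply: subringM; [exact: subringX|exact: subringM].
  by rewrite mulKf // mulrAC -exprSr divff // expf_neq0.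
Qed.

(** The valuations of a and a^-1 add up to that of 1, which is 0, so one of them is nonnegative. *)
Lemma dvr_valuation_ring : valuation_ring O.
Proof.
split=> // a; have [->|a0] := eqVneq a 0; first by left; exact: subring0.
have a'0 : a^-1 != 0 by rewrite invr_eq0.
have /eqP := valuation_ofM a0 a'0; rewrite divff //.
have -> : valuation_of 1 = 0.
  apply: (addrI (valuation_of 1)).
  by rewrite -valuation_ofM ?oner_neq0 // mulr1 addr0.
rewrite eq_sym addrC addr_eq0 => /eqP va.
case: (lerP 0 (valuation_of a)) => [|vlt0].
  by move/(valuation_of_ge0 a0); left.
by right; apply/(valuation_of_ge0 a'0); rewrite va oppr_ge0 ltW.
Qed.

End Subring.

(** By multiplicativity, agreement on R passes to quotients of elements of R, hence to all nonzero
    elements of K; each ring is then recovered as the elements of nonnegative valuation, together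
    with 0. The ring R will be the local ring of S at s. *)
Lemma valuation_of_inj (K : fieldType) (O1 O2 R : set K) :
  is_subring O1 -> is_subring O2 ->
  discrete_valuation_ring O1 -> discrete_valuation_ring O2 ->
  (forall a, exists b c, [/\ R b, R c, c != 0 & a = b / c]) ->
  (forall f, R f -> f != 0 -> valuation_of O1 f = valuation_of O2 f) ->
  O1 = O2.
Proof.
move=> s1 s2 d1 d2 fracR eqR.
have eqK a : a != 0 -> valuation_of O1 a = valuation_of O2 a.
  move=> a0; have [b [c [Rb Rc c0 aE]]] := fracR a.
  have bE : a * c = b by rewrite aE divfK.
  have b0 : b != 0 by rewrite -bE mulf_neq0.
  have := eqR b Rb b0; rewrite -bE !valuation_ofM // (eqR c) //.
  exact: addIr.
apply/seteqP; split=> a; have [->|a0] := eqVneq a 0.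
- by move=> _; exact: subring0.
- by move/(valuation_of_ge0 s1 d1 a0); rewrite eqK // => /(valuation_of_ge0 s2 d2 a0).
- by move=> _; exact: subring0.
- by move/(valuation_of_ge0 s2 d2 a0); rewrite -eqK // => /(valuation_of_ge0 s1 d1 a0).
Qed.

(** If a nonzero f were divisible by every power of t, the increasing ideals O f/t^n would have a
    finitely generated union [I], so f/t^(N+1) = a f/t^N for some a in O, and a t = 1. So only
    finitely many powers of t divide f, and dividing f in O by the largest one leaves a unit;
    fractions follow. *)
Lemma noetherian_dvr (K : fieldType) (O : set K) t :
  is_subring O -> noetherian_ring O -> uniformizer O t ->
  (forall a, exists b c, [/\ O b, O c, c != 0 & a = b / c]) ->
  discrete_valuation_ring O.
Proof.
move=> sO noethO ut fracO; exists t => //.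
have nt := uniformizer_nonunit sO ut.
have [t0 tE] := ut; have [Ot _] := nt.
have fin f : f != 0 -> exists n, ~ O (f / t ^+ n).
  move=> f0; apply: contrapT => /forallNP h.
  have {}h n : O (f / t ^+ n) by apply: contrapT; exact: h.
  pose I := [set x | exists n, exists2 a, O a & x = a * (f / t ^+ n)].
  have up n m a : O a -> exists2 b, O b & a * (f / t ^+ n) = b * (f / t ^+ (n + m)).
    move=> Oa; exists (a * t ^+ m); first by apply: subringM => //; exact: subringX.
    rewrite exprD invfM -!mulrA; congr (_ * _).
    by rewrite [RHS]mulrCA [t ^+ m * _]mulrCA divff ?expf_neq0 // mulr1.
  have idI : is_ideal O I.
    split.
    - by move=> _ [n [a Oa ->]]; apply: subringM.
    - by exists 0%N, 0; [exact: subring0|rewrite mul0r].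
    - move=> a x y Oa [n [b Ob ->]] [m [c Oc ->]].
      have [b' Ob' ->] := up n m b Ob; have [c' Oc' ->] := up m n c Oc.
      rewrite addnC; exists (m + n)%N, (a * b' + c').
        by apply: subringD => //; exact: subringM.
      by rewrite mulrDl mulrA.
  have [d [g IE]] := noethO _ idI.
  have gI i : I (g i).
    rewrite IE; exists (fun j => (j == i)%:R).
      by move=> j; case: (j == i); [exact: subring1|exact: subring0].
    rewrite (bigD1 i) //= eqxx mul1r big1 ?addr0 // => j /negPf ->.
    by rewrite mul0r.
  have [N gN] : exists N, forall i, exists2 a, O a & g i = a * (f / t ^+ N).
    have /choice[e eP] := gI.
    (* Since the ideals increase, the sum of the finitely many exponents serves all generators at
       once. *)
    exists (\sum_i e i)%N => i; have [a Oa ->] := eP i.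
    by rewrite (bigD1 i) //=; apply: up.
  have : I (f / t ^+ N.+1).
    by exists N.+1, 1; [exact: subring1|rewrite mul1r].
  rewrite IE => -[c Oc E].
  have [a Oa aE] : exists2 a, O a & f / t ^+ N.+1 = a * (f / t ^+ N).
    rewrite E; elim/big_ind: _.
    - by exists 0; [exact: subring0|rewrite mul0r].
    - move=> _ _ [a Oa ->] [b Ob ->]; exists (a + b); last by rewrite mulrDl.
      exact: subringD.
    - move=> i _; have [a Oa ->] := gN i.
      by exists (c i * a); [apply: subringM|rewrite mulrA].
  apply: (nonunit_mul nt Oa).
  have q0 : f / t ^+ N.+1 != 0 by rewrite mulf_neq0 // invr_eq0 expf_neq0.
  apply: (mulIf q0); rewrite mul1r {2}aE -mulrA; congr (_ * _).
  rewrite exprS; have := expf_neq0 N t0; move: (t ^+ N) => b b0.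
  by field; rewrite t0 b0.
have int_case f : O f -> f != 0 ->
    exists u (n : int), unit_in O u /\ f = u * t ^ n.
  move=> Of f0.
  have exb : exists n, `[< ~ O (f / t ^+ n) >].
    by have [n nO] := fin f f0; exists n; apply/asboolP.
  (* The least exponent that fails is some [n.+1], as exponent 0 works for f in O. Then f/t^n lies
     in O but is not a multiple of t, so it is a unit. *)
  have [[|n] /asboolP nO minn] := ex_minnP exb.
    by exfalso; apply: nO; rewrite expr0 divr1.
  exists (f / t ^+ n), n; split; last by rewrite -exprnP divfK // expf_neq0.
  apply/unit_inP => //; split.
    apply: contrapT => h; have /minn : `[< ~ O (f / t ^+ n) >] by apply/asboolP.
    by rewrite ltnn.
  rewrite tE => -[a Oa aE]; apply: nO.
  by rewrite exprSr invfM mulrA -aE mulfK.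
move=> f f0; have [b [c [Ob Oc c0 fE]]] := fracO f.
have b0 : b != 0 by apply: contraNneq f0 => b0; rewrite fE b0 mul0r.
have [u [n [uu bE]]] := int_case b Ob b0.
have [v [m [uv cE]]] := int_case c Oc c0.
exists (u / v), (n - m); split.
  by apply: unit_inM => //; exact: unit_inV.
by rewrite fE bE cE expfzDr // -invr_expz invfM mulrACA.
Qed.

(** * Closures of points and irreducible closed sets *)

Lemma open_closure_singleton (T : topologicalType) (x y : T) (N : set T) :
  closure [set x] y -> open N -> N y -> N x.
Proof.
move=> xy oN Ny; have [_ [-> //]] := xy N (open_nbhs_nbhs (conj oN Ny)).
Qed.

Lemma closure_singleton_sub (T : topologicalType) (x : T) (F : set T) :
  closed F -> F x -> closure [set x] `<=` F.
Proof.
by move=> /closure_id cF Fx; rewrite cF; apply: closure_subset => _ ->.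
Qed.

Lemma irreducible_closure_singleton (T : topologicalType) (x : T) :
  @irreducible_closed T (closure [set x]).
Proof.
split; first exact: closed_closure.
split; first by exists x; apply: subset_closure.
move=> F G cF cG /(_ x (subset_closure erefl))[Fx|Gx]; [left|right];
  exact: closure_singleton_sub.
Qed.

Lemma irreducible_meet (T : topologicalType) (Z V W : set T) :
  irreducible_subset Z -> open V -> open W ->
  Z `&` V !=set0 -> Z `&` W !=set0 -> Z `&` (V `&` W) !=set0.
Proof.
move=> [_ irrZ] oV oW [x [Zx Vx]] [y [Zy Wy]]; apply: contrapT => h.
have [||z Zz||] := irrZ (~` V) (~` W).
- exact: open_closedC.
- exact: open_closedC.
- rewrite -setCI => VWz; apply: h; by exists z.
- by move/(_ x Zx); apply.
- by move/(_ y Zy); apply.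
Qed.

(** * Points of an affine chart as prime ideals *)

Section Chart.
Variables (K : fieldType) (T : topologicalType) (st : T -> set K).
Variables (U : set T) (A : set K) (phi : T -> set K).

(** The condition on [phi] inside [affine_chart], named so that one identification with the spectrum
    can be kept fixed. *)
Definition chart_map : Prop :=
  [/\ set_bij U (prime_spectrum A) phi,
      forall B, B `<=` U ->
        (open B <-> exists2 I, I `<=` A & B = [set x | U x /\ ~ I `<=` phi x]) &
      forall x, U x -> st x = localization A (phi x)].

Hypotheses (openU : open U) (subringA : is_subring A).
Hypothesis fracA : localization A [set 0] = setT.
Hypothesis phiP : chart_map.

Lemma chart_prime x : U x -> prime_ideal A (phi x).
Proof. by case: phiP => -[phiU _ _] _ _; exact: phiU. Qed.

Lemma chart_point P : prime_ideal A P -> exists2 x, U x & phi x = P.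
Proof. by case: phiP => -[_ _ /(_ P)] + _ _ pP => /(_ pP)[x Ux <-]; exists x. Qed.

Lemma chart_basic_open a : A a -> open [set x | U x /\ ~ phi x a].
Proof.
move=> Aa; case: phiP => _ + _; set B := [set x | _] => /(_ B).
have BU : B `<=` U by move=> x [].
move=> /(_ BU) ->; exists [set a]; first by move=> _ ->.
apply/seteqP; split=> x [Ux]; first by move=> nax; split=> // /(_ a erefl).
by move=> nax; split=> // ax; apply: nax => _ ->.
Qed.

(** Specialization is inclusion of primes. An element of [phi x] outside [phi y] would give a basic
    open set around y that misses x. Conversely, an open set of the chart is cut out by some I, and
    I not inside [phi y] is not inside the smaller [phi x]. *)
Lemma chart_closureP x y : U x -> U y ->
  closure [set x] y <-> phi x `<=` phi y.
Proof.
move=> Ux Uy; split=> [xy a ax|xy].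
  have [[phiA _ _] _ _] := chart_prime Ux.
  apply: contrapT => nay.
  by have [] := open_closure_singleton xy (chart_basic_open (phiA _ ax))
    (conj Uy nay).
move=> B /=; rewrite nbhsE /= => -[N [oN Ny] NB].
exists x; split=> //; apply: NB.
have [_ /(_ (N `&` U)) + _] := phiP.
have NU : N `&` U `<=` U by move=> z [].
move=> /(_ NU)[/(_ (openI oN openU))[I IA NUE] _].
have : (N `&` U) y by [].
rewrite NUE => -[_ nI]; suff : (N `&` U) x by case.
by rewrite NUE; split=> // Ix; apply: nI => a /Ix/xy.
Qed.

Lemma chart_closure_inj x y : U x -> U y ->
  closure [set x] = closure [set y] -> x = y.
Proof.
move=> Ux Uy xy; have [[_ phi_inj _] _ _] := phiP.
apply: phi_inj; rewrite ?inE //; apply/seteqP; split.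
- by apply/chart_closureP => //; rewrite xy; apply: subset_closure.
- by apply/chart_closureP => //; rewrite -xy; apply: subset_closure.
Qed.

(* The prime of the generic point is the intersection of the primes of the
   points of Z lying in the chart. *)
Lemma chart_generic_point Z : @irreducible_closed T Z -> Z `&` U !=set0 ->
  exists2 x, U x & Z = closure [set x].
Proof.
move=> [cZ irrZ] ZU0; have [z0 [Zz0 Uz0]] := ZU0.
pose P := [set a | A a /\ forall z, Z z -> U z -> phi z a].
have PP : prime_ideal A P.
  split.
  - split; first by move=> a [].
      split; first exact: subring0.
      by move=> z Zz Uz; have [[]] := chart_prime Uz.
    move=> a x y Aa [Ax xP] [Ay yP]; split.
      by apply: subringD => //; exact: subringM.
    move=> z Zz Uz; have [[_ _ lin] _ _] := chart_prime Uz.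
    by apply: lin => //; [exact: xP|exact: yP].
  - by move=> [_ /(_ z0 Zz0 Uz0)]; have [] := chart_prime Uz0.
  - move=> a b Aa Ab [_ abP].
    have [||z Zz||] := irrZ.2 (~` [set x | U x /\ ~ phi x a])
                              (~` [set x | U x /\ ~ phi x b]).
    + by apply: open_closedC; exact: chart_basic_open.
    + by apply: open_closedC; exact: chart_basic_open.
    + rewrite -setCI => -[[Uz naz] [_ nbz]].
      have [_ _ pz] := chart_prime Uz.
      by case: (pz a b Aa Ab (abP z Zz Uz)).
    + move=> h; left; split=> // z Zz Uz; apply: contrapT => nz.
      exact: (h z Zz).
    + move=> h; right; split=> // z Zz Uz; apply: contrapT => nz.
      exact: (h z Zz).
have [x Ux phix] := chart_point PP; exists x => //.
have Zx : Z x.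
  apply: contrapT => nZx.
  have [_ /(_ (~` Z `&` U)) + _] := phiP.
  have CU : ~` Z `&` U `<=` U by move=> z [].
  move=> /(_ CU)[/(_ (openI (closed_openC cZ) openU))[I IA CUE] _].
  have : (~` Z `&` U) x by [].
  rewrite CUE /= phix => -[_]; apply=> a Ia; split; first exact: IA.
  move=> z Zz Uz; apply: contrapT => naz.
  have : (~` Z `&` U) z by rewrite CUE; split=> // /(_ a Ia).
  by case.
apply/seteqP; split; last exact: closure_singleton_sub.
move=> y Zy N /=; rewrite nbhsE /= => -[V [oV Vy] VN].
have [z [Zz [Uz Vz]]] := irreducible_meet irrZ openU oV ZU0 (ex_intro _ y (conj Zy Vy)).
exists x; split=> //; apply: VN.
apply: (@open_closure_singleton _ x z) => //.
by apply/chart_closureP => //; rewrite phix => a [_]; apply.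
Qed.

(** The closure of x contains U, since 0 lies in every prime. So this closure and the complement of
    U cover the irreducible space, and the complement misses x. *)
Lemma chart_zero_dense x : irreducible_subset [set: T] -> U x ->
  phi x `<=` [set 0] -> closure [set x] = setT.
Proof.
move=> [_ irrT] Ux x0; apply/seteqP; split=> // y _.
have [||z _||] := irrT (closure [set x]) (~` U).
- exact: closed_closure.
- exact: open_closedC.
- have [Uz|] := pselect (U z); last by right.
  left; apply/chart_closureP => // _ /x0 ->.
  by have [[]] := chart_prime Uz.
- exact.
- by move/(_ x I).
Qed.

Lemma chart_dense_point : irreducible_subset [set: T] ->
  exists2 x, U x & closure [set x] = setT /\ st x = setT.
Proof.
move=> irrT.
have P0 : prime_ideal A [set 0].
  split.
  - split; [by move=> _ ->; exact: subring0|by []|].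
    by move=> a _ _ _ -> ->; rewrite /= mulr0 addr0.
  - by apply/eqP; rewrite oner_eq0.
  - by move=> a b _ _ /= /eqP; rewrite mulf_eq0 => /orP[]/eqP; [left|right].
have [x Ux phix] := chart_point P0; exists x => //; split.
  by apply: chart_zero_dense => //; rewrite phix.
by have [_ _ ->] := phiP; rewrite // phix.
Qed.

(** * Localization at a prime and contraction of primes *)

Section Localization.
Variable (P : set K).
Hypothesis primeP : prime_ideal A P.

Lemma prime_neq0 b : ~ P b -> b != 0.
Proof. by case: primeP => -[_ P0 _] _ _ nb; apply/eqP => b0; rewrite b0 in nb. Qed.

Lemma prime_compl_mul a b : A a -> A b -> ~ P a -> ~ P b -> ~ P (a * b).
Proof. by case: primeP => _ _ pP Aa Ab na nb /(pP a b Aa Ab)[]. Qed.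

Lemma localization_sub : A `<=` localization A P.
Proof.
move=> a Aa; exists a, 1; case: primeP => _ n1 _; split=> //.
- exact: subring1.
- by rewrite divr1.
Qed.

Lemma localization_inv b : A b -> ~ P b -> localization A P b^-1.
Proof.
by move=> Ab nb; exists 1, b; split; rewrite ?div1r //; exact: subring1.
Qed.

Lemma is_subring_localization : is_subring (localization A P).
Proof.
split.
- by rewrite in_setE; apply: localization_sub; exact: subring1.
- move=> x y; rewrite !in_setE => -[a [b [Aa Ab nb ->]]] [c [d [Ac Ad nd ->]]].
  exists (a * d - c * b), (b * d); split.
  + by apply: subringB => //; exact: subringM.
  + exact: subringM.
  + exact: prime_compl_mul.
  + by field; rewrite !prime_neq0.
- move=> x y; rewrite !in_setE => -[a [b [Aa Ab nb ->]]] [c [d [Ac Ad nd ->]]].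
  exists (a * c), (b * d); split; [exact: subringM..| |].
  + exact: prime_compl_mul.
  + by rewrite invfM mulrACA.
Qed.

Lemma localization_frac a :
  exists b c, [/\ localization A P b, localization A P c, c != 0 & a = b / c].
Proof.
have : localization A [set 0] a by rewrite fracA.
move=> [b [c [Ab Ac c0 ->]]]; exists b, c.
by split=> //; [exact: localization_sub..|apply/eqP].
Qed.

Lemma prime_nonunits : P `<=` nonunits (localization A P).
Proof.
move=> a Pa; have [[PA P0 lin] _ _] := primeP; split.
  by apply: localization_sub; exact: PA.
move=> _ [c [d [Ac Ad nd ->]]] acd; apply: (nd).
have d0 := prime_neq0 nd.
have -> : d = c * a + 0 by rewrite addr0 mulrC -[RHS](divfK d0) -(mulrA a) acd mul1r.
exact: lin.
Qed.

Lemma contract_prime Q : prime_ideal (localization A P) Q ->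
  prime_ideal A (Q `&` A) /\ Q `&` A `<=` P.
Proof.
move=> [[QO Q0 lin] n1 pQ]; split; first split.
- split; [by move=> a []|by split=> //; exact: subring0|].
  move=> a x y Aa [Qx Ax] [Qy Ay]; split.
    by apply: lin => //; exact: localization_sub.
  by apply: subringD => //; exact: subringM.
- by case.
- move=> a b Aa Ab [Qab _].
  by have [] := pQ a b (localization_sub Aa) (localization_sub Ab) Qab; [left|right].
(* An element of Q in A outside P is invertible in the localization, which would put 1 in Q. *)
- move=> a [Qa Aa]; apply: contrapT => na; apply: n1.
  have -> : 1 = a^-1 * a + 0 by rewrite addr0 mulVf // prime_neq0.
  by apply: lin => //; exact: localization_inv.
Qed.

(** A fraction a/b of the localization lies in a prime exactly when its numerator does, so
    inclusions of primes are detected on A. *)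
Lemma contract_inj Q Q' : prime_ideal (localization A P) Q ->
  prime_ideal (localization A P) Q' -> Q' `&` A `<=` Q -> Q' `<=` Q.
Proof.
move=> [[QO Q0 lin] _ _] [[QO' Q0' lin'] _ _] sub x Q'x.
have [a [b [Aa Ab nb xE]]] := QO' _ Q'x.
have b0 := prime_neq0 nb.
have Qa : Q a.
  apply: sub; split=> //.
  have -> : a = b * x + 0 by rewrite addr0 xE mulrC divfK.
  by apply: lin' => //; exact: localization_sub.
have -> : x = b^-1 * a + 0 by rewrite addr0 xE mulrC.
by apply: lin => //; exact: localization_inv.
Qed.

End Localization.
End Chart.

(** * Generic points and stalks of an integral scheme *)

Section Scheme.
Variables (K : fieldType) (X : integral_scheme K).

Lemma scheme_chart (x : X) : exists U A phi,
  [/\ U x, open U, is_subring A, localization A [set 0] = setT &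
      chart_map (@stalk K X) U A phi].
Proof.
have [U [A [Ux [oU sA fA [phi phiP]]]]] := scheme_locally_affine x.
by exists U, A, phi.
Qed.

Lemma generic_point (Z : set X) : @irreducible_closed X Z ->
  exists x, Z = closure [set x].
Proof.
move=> iZ; have [_ [[x Zx] _]] := iZ.
have [U [A [phi [Ux oU sA fA phiP]]]] := scheme_chart x.
have [y _ ZE] := chart_generic_point oU sA phiP iZ (ex_intro _ x (conj Zx Ux)).
by exists y.
Qed.

Lemma generic_point_inj (x y : X) : closure [set x] = closure [set y] -> x = y.
Proof.
move=> xy; have [U [A [phi [Ux oU sA fA phiP]]]] := scheme_chart x.
apply: (chart_closure_inj oU phiP) => //.
by apply: open_closure_singleton Ux => //; rewrite -xy; apply: subset_closure.
Qed.

Lemma local_ring_along_generic (x : X) :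
  local_ring_along (closure [set x]) = stalk x.
Proof.
apply/seteqP; split=> a; last by exists x.
by move=> [y /generic_point_inj ->].
Qed.

(** The generic point of X has stalk K, so the identity of K defines a morphism from Spec K, to
    which the valuative criterion will be applied. *)
Lemma dense_point (x : X) :
  exists z : X, closure [set z] = setT /\ stalk z = setT.
Proof.
have [U [A [phi [Ux oU sA fA phiP]]]] := scheme_chart x.
have [z _ zP] := chart_dense_point oU sA fA phiP (@scheme_irreducible K X).
by exists z.
Qed.

Lemma is_subring_stalk (x : X) : is_subring (stalk x).
Proof.
have [U [A [phi [Ux oU sA fA phiP]]]] := scheme_chart x.
have [_ _ ->//] := phiP; apply: is_subring_localization => //.
exact: (chart_prime phiP).
Qed.

Lemma stalk_frac (x : X) a :
  exists b c, [/\ stalk x b, stalk x c, c != 0 & a = b / c].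
Proof.
have [U [A [phi [Ux oU sA fA phiP]]]] := scheme_chart x.
have [_ _ ->//] := phiP; apply: localization_frac => //.
exact: (chart_prime phiP).
Qed.

(** Regularity provides as many generators of the maximal ideal as the dimension d. Here d = 0 would
    force the maximal ideal to be 0, d = 1 makes it principal, and d at least 2 contradicts
    codimension 1. *)
Lemma stalk_prime_divisor_dvr (x : X) : regular_local_ring (stalk x) ->
  prime_divisor (closure [set x]) -> discrete_valuation_ring (stalk x).
Proof.
move=> [noeth [d [g [[chain _] nE]]]] [_ EnT codim1].
have sO := is_subring_stalk x; have fO := stalk_frac x.
have [U [A [phi [Ux oU sA fA phiP]]]] := scheme_chart x.
have pP := chart_prime phiP Ux.
have stE : stalk x = localization A (phi x) by have [_ _ ->] := phiP.
(* If the prime of x were zero, x would be dense, although a prime divisor is not the whole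
   space. *)
have [a Pa a0] : exists2 a, phi x a & a != 0.
  apply: contrapT => h; apply: EnT.
  apply: (chart_zero_dense oU phiP) => //; first exact: scheme_irreducible.
  by move=> a Pa; apply/eqP; apply: contrapT => /negP a0; apply: h; exists a.
have na : nonunits (stalk x) a by rewrite stE; exact: prime_nonunits.
case: d g chain nE => [|[|d]] g [Q [Qp Qlt]] nE.
- by move: na; rewrite nE => -[c _]; rewrite big_ord0 => /eqP; rewrite (negPf a0).
- have nE1 : nonunits (stalk x) = [set b * g ord0 | b in stalk x].
    rewrite nE; apply/seteqP; split=> y.
      by move=> [c Oc ->]; rewrite big_ord1; exists (c ord0).
    by move=> [b Ob <-]; exists (fun=> b) => //; rewrite big_ord1.
  apply: (noetherian_dvr sO noeth _ fO (t := g ord0)); split=> //.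
  move: na; rewrite nE1 => -[b _ ba]; apply: contraNneq a0 => g0.
  by rewrite -ba g0 mulr0.
- exfalso.
  (* The first three primes of the chain contract to primes inside [phi x], hence to points
     specializing to x. Codimension 1 leaves only two possible closures for these three points. *)
  have point i : (i <= 2)%N -> exists y, [/\ U y, phi y = Q i `&` A &
      closure [set y] = closure [set x] \/ closure [set y] = setT].
    move=> i2; have := Qp i (leq_trans i2 _); rewrite stE => /(_ isT) pQ.
    have [pQA QAP] := contract_prime sA pP pQ.
    have [y Uy phiy] := chart_point phiP pQA; exists y; split=> //.
    apply: codim1; first exact: irreducible_closure_singleton.
    apply: closure_singleton_sub; first exact: closed_closure.
    by apply/(chart_closureP oU phiP) => //; rewrite phiy.
  have distinct i j y z : Q i `<` Q j -> (i <= 2)%N -> (j <= 2)%N ->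
      phi y = Q i `&` A -> phi z = Q j `&` A ->
      closure [set y] = closure [set z] -> False.
    move=> [_ nji] i2 j2 yE zE /generic_point_inj yz; apply: nji.
    have pQ l : (l <= 2)%N -> prime_ideal (localization A (phi x)) (Q l).
      by move=> l2; rewrite -stE; apply: Qp; exact: leq_trans l2 _.
    apply: (contract_inj sA pP (pQ i i2) (pQ j j2)).
    by rewrite -zE -yz yE; exact: subIsetl.
  have [Q01 Q12] : Q 0%N `<` Q 1%N /\ Q 1%N `<` Q 2%N by split; exact: Qlt.
  have Q02 : Q 0%N `<` Q 2%N.
    case: Q01 Q12 => Q01 _ [Q12 n21]; split; first exact: subset_trans Q12.
    by move=> Q20; apply: n21; exact: subset_trans Q01.
  have [y0 [_ e0 c0]] := point 0%N isT.
  have [y1 [_ e1 c1]] := point 1%N isT.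
  have [y2 [_ e2 c2]] := point 2%N isT.
  have d01 := distinct _ _ _ _ Q01 isT isT e0 e1.
  have d12 := distinct _ _ _ _ Q12 isT isT e1 e2.
  have d02 := distinct _ _ _ _ Q02 isT isT e0 e2.
  (* By the pigeonhole principle two of the three closures coincide, against the strictness of the
     chain. *)
  by case: c0 d01 d02 => ->; case: c1 d12 => ->; case: c2 => -> d12 d01 d02;
    solve [exact: d01 | exact: d12 | exact: d02].
Qed.

End Scheme.

(** * Exceptional curves and their orders on the local ring at s *)

Section Desingularization.
Variables (K : fieldType) (X S : integral_scheme K) (p : X -> S) (s : S).
Hypothesis desing_p : desingularization p.

Lemma exceptional_generic_point E : exceptional_curve p s E ->
  exists x : X,
    [/\ E = closure [set x], p x = s & discrete_valuation_ring (stalk x)].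
Proof.
case: desing_p => _ _ regX [primeE pE].
have [x Ex] := generic_point (let: And3 irr _ _ := primeE in irr).
exists x; split=> //.
  suff : (p @` E) (p x) by rewrite pE.
  by exists x => //; rewrite Ex; apply: subset_closure.
by apply: stalk_prime_divisor_dvr => //; rewrite -Ex.
Qed.

(* Uniqueness in the valuative criterion, for L = K and W the common stalk. *)
Lemma fiber_stalk_inj (x y : X) : p x = s -> p y = s ->
  valuation_ring (stalk x) -> stalk x = stalk y -> x = y.
Proof.
move=> px py vx xy; have [[cont_p birat loc] [_ proper_p] _] := desing_p.
have [z [zT stz]] := dense_point x.
have homz : local_hom_to_field (stalk z) (@id K).
  split=> // a _; rewrite stz; split=> [->|[_ na]].
    by split=> // b _; rewrite mul0r => /esym/eqP; rewrite oner_eq0.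
  by apply: contrapT => /eqP a0; apply: (na a^-1) => //; rewrite divff.
have ext_s : extends_to_valuation_ring (p z) id (stalk x) s.
  split.
  - have : closure [set z] x by rewrite zT.
    rewrite -px => zx B pB; have [_ [-> pzB]] := zx _ (cont_p x B pB).
    by exists (p z).
  - by move=> a; rewrite -px; exact: birat.
  - by move=> a; rewrite -px; exact: loc.
have [x' [_ uniq]] := proper_p z K id (stalk x) s homz vx ext_s.
rewrite -(uniq x); first rewrite -(uniq y) //.
- by split=> //; split; rewrite ?zT // -xy.
- by split=> //; split; rewrite ?zT.
Qed.

(** Both claims of the theorem rest on this: its contrapositive separates distinct curves, and
    antisymmetry is the case where two inequalities give equal orders. *)
Lemma exceptional_ord_inj E F :
  exceptional_curve p s E -> exceptional_curve p s F ->
  (forall f, stalk s f -> ord E f = ord F f) -> E = F.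
Proof.
move=> /exceptional_generic_point[x [-> px dvrx]].
move=> /exceptional_generic_point[y [-> py dvry]] ordE.
have sx := is_subring_stalk x; have sy := is_subring_stalk y.
congr (closure [set _]); apply: fiber_stalk_inj => //.
  exact: dvr_valuation_ring.
(* K is the fraction field of the stalk at s, so agreement of the orders there forces the stalks at
   the two generic points to coincide. *)
apply: (valuation_of_inj sx sy dvrx dvry (stalk_frac s)) => f sf f0.
have := ordE f sf; rewrite /ord /principal_divisor (negPf f0).
by rewrite !local_ring_along_generic => -[].
Qed.

End Desingularization.

Theorem mainTheorem5 (k : closedFieldType) (K : fieldType)
    (iota : {rmorphism k -> K})
    (S : integral_scheme K) (s : S)
    (S_rational : rational_surface_singularity iota s)
    (X : integral_scheme K) (p : X -> S)
    (p_minimal : minimal_desingularization p) :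
  (forall E F : set X,
     exceptional_curve p s E -> exceptional_curve p s F -> E <> F ->
     exists f : K, stalk s f /\ ord E f <> ord F f) /\
  Relation_Definitions.order {E : set X | exceptional_curve p s E}
    (@exceptional_le K X S p s).
Proof.
have [desing_p _] := p_minimal; split=> [E F excE excF EF|].
  apply: contrapT => /forallNP h; apply: EF.
  apply: (exceptional_ord_inj desing_p excE excF) => f sf.
  by apply: contrapT => neq; apply: (h f).
split.
- by move=> E f _.
- by move=> E F G EF FG f sf; exact: le_trans (EF f sf) (FG f sf).
(* Elements of the ordered type carry a proof of exceptionality; by proof irrelevance it suffices to
   equate the underlying sets. *)
- move=> [E excE] [F excF] EF FE; apply: eq_exist => /=.
  apply: (exceptional_ord_inj desing_p excE excF) => f sf.
  by apply/eqP; rewrite eq_le (EF f sf) (FE f sf).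
Qed.
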